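(* The Zaremba–Jaumann rate, the Green–Naghdi rate and the logarithmic rate are positive corotational rates, whereas the Gurtin–Spear rate is not a positive corotational rate. That is, for $B\in\mathrm{Sym}^{++}(3)$ with $V=\sqrt B$ and a function $g$ on pairs of distinct positive numbers, put $$\mathbb{A}_g(B).D = B D + D B+\sum_{\substack{\mu,\nu\in\mathrm{spec}(V)\\ \mu\neq\nu}} g(\mu,\nu)\,(\mu^2-\nu^2)\,P_\mu\, D\, P_\nu,\qquad D\in\mathrm{Sym}(3),$$ where $\mathrm{spec}(V)$ is the set of distinct eigenvalues of $V$ and $P_\mu$ is the orthogonal projection onto the eigenspace of $V$ for $\mu$. Then for each of $$g^{\mathrm{ZJ}}(\mu,\nu)=0,\qquad g^{\mathrm{GN}}(\mu,\nu)=\frac{\nu-\mu}{\mu+\nu},\qquad g^{\log}(\mu,\nu)=\frac{\mu^2+\nu^2}{\nu^2-\mu^2}+\frac{1}{\log\mu-\log\nu}$$ one has $\langle\mathbb{A}_g(B).D,D\rangle>0$ for all $B\in\mathrm{Sym}^{++}(3)$ and all $D\in\mathrm{Sym}(3)\setminus\{0\}$, while for $$g^{\mathrm{GS}}(\mu,\nu)=\frac{\mu^2+\nu^2}{\nu^2-\mu^2}$$ this property fails.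
   Context: $\mathrm{Sym}(3)$ denotes the real symmetric $3\times3$ matrices, $\mathrm{Sym}^{++}(3)$ the positive definite ones, $\langle X,Y\rangle=\mathrm{tr}(XY^T)$. In the mechanical setting $F$ is the deformation gradient of a motion, $B=FF^T=V^2$, $L=\dot FF^{-1}$, $D=\frac12(L+L^T)$, $W=\frac12(L-L^T)$. A corotational rate is $\frac{\mathrm{D}^{\circ}}{\mathrm{D}t}[B]=\frac{\mathrm{D}}{\mathrm{D}t}[B]-\Omega^{\circ}B+B\Omega^{\circ}$ with $\Omega^{\circ}$ skew-symmetric; it is called positive if $\langle\frac{\mathrm{D}^{\circ}}{\mathrm{D}t}[B],D\rangle>0$ for all $B\in\mathrm{Sym}^{++}(3)$ and all $D\in\mathrm{Sym}(3)\setminus\{0\}$. The four rates named are those with spin $\Omega^{\circ}=W+\sum_{\mu\neq\nu}g(\mu,\nu)P_\mu D P_\nu$ for $g=g^{\mathrm{ZJ}},g^{\mathrm{GN}},g^{\log},g^{\mathrm{GS}}$ respectively, and for them $\frac{\mathrm{D}^{\circ}}{\mathrm{D}t}[B]=\mathbb{A}_g(B).D$. The sum is zero if $V$ has only one distinct eigenvalue. *)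

(* Defs.v *)
From mathcomp Require Import all_boot all_order all_algebra.
From mathcomp Require Import sesquilinear.
From mathcomp Require Import all_classical all_reals all_analysis.
Set Implicit Arguments.
Unset Strict Implicit.
Unset Printing Implicit Defensive.
Import Order.TTheory GRing.Theory Num.Theory.
Import numFieldNormedType.Exports.
Local Open Scope classical_set_scope.
Local Open Scope ring_scope.

Section Algebra.
Context {R : realType}.
Implicit Types (A B D V X Y : 'M[R]_3) (g : R -> R -> R).

Definition inner X Y : R := \tr (X *m Y^T).

Definition posdefmx A : Prop :=
  A \is symmetricmx /\
  forall v : 'cV[R]_3, v != 0 -> 0 < (v^T *m A *m v) 0 0.

(* The positive definite square root, selected by its defining property; it
   exists and is unique for B in Sym++(3), and the default 0 is otherwise
   irrelevant. *)
Definition sqrtmx B : 'M[R]_3 := xget 0 [set V | posdefmx V /\ V *m V = B].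

(* Orthogonal projection onto the eigenspace of V for mu. MathComp matrices act
   on row vectors; for symmetric V the left and right eigenspaces are
   transposes of each other and the orthogonal projection is symmetric, so the
   two conventions give the same matrix. *)
Definition eigenproj V (mu : R) : 'M[R]_3 :=
  proj_mx (eigenspace V mu) (orthomx idfun 1%:M (eigenspace V mu)).

Definition distinct_eigenpairs V : set (R * R) :=
  [set p | [/\ eigenvalue V p.1, eigenvalue V p.2 & p.1 != p.2]].

(* V has finitely many eigenvalues, so the finitely supported sums below range
   over all ordered pairs of distinct eigenvalues. *)
Definition spin_sum g V D : 'M[R]_3 :=
  \sum_(p \in distinct_eigenpairs V)
    g p.1 p.2 *: (eigenproj V p.1 *m D *m eigenproj V p.2).

Definition Aop g B D : 'M[R]_3 :=
  B *m D + D *m B +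
  \sum_(p \in distinct_eigenpairs (sqrtmx B))
    (g p.1 p.2 * (p.1 ^+ 2 - p.2 ^+ 2)) *:
      (eigenproj (sqrtmx B) p.1 *m D *m eigenproj (sqrtmx B) p.2).

Definition Aop_positive g : Prop :=
  forall B D, posdefmx B -> D \is symmetricmx -> D != 0 ->
    0 < inner (Aop g B D) D.

Definition gZJ (mu nu : R) : R := 0.
Definition gGN (mu nu : R) : R := (nu - mu) / (mu + nu).
Definition glog (mu nu : R) : R :=
  (mu ^+ 2 + nu ^+ 2) / (nu ^+ 2 - mu ^+ 2) + 1 / (ln mu - ln nu).
Definition gGS (mu nu : R) : R :=
  (mu ^+ 2 + nu ^+ 2) / (nu ^+ 2 - mu ^+ 2).

End Algebra.

Section Kinematics.
Context {R : realType}.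
Implicit Types (F : R -> 'M[R]_3) (t : R) (g : R -> R -> R).

(* The deformation gradient of a motion at a fixed material point, as a
   function of time; at a fixed material point D/Dt is d/dt. *)
Definition deformation_gradient F : Prop :=
  forall t, derivable F t 1 /\ 0 < \det (F t).

Definition left_cauchy_green F t : 'M[R]_3 := F t *m (F t)^T.
Definition velocity_gradient F t : 'M[R]_3 := derive1 F t *m invmx (F t).
Definition stretching F t : 'M[R]_3 :=
  2^-1 *: (velocity_gradient F t + (velocity_gradient F t)^T).
Definition vorticity F t : 'M[R]_3 :=
  2^-1 *: (velocity_gradient F t - (velocity_gradient F t)^T).

Definition spin_law := (R -> 'M[R]_3) -> R -> 'M[R]_3.
Implicit Type Omega : spin_law.

Definition spin_of g : spin_law := fun F t =>
  vorticity F t + spin_sum g (sqrtmx (left_cauchy_green F t)) (stretching F t).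

Definition rate Omega F t : 'M[R]_3 :=
  derive1 (left_cauchy_green F) t
  - Omega F t *m left_cauchy_green F t + left_cauchy_green F t *m Omega F t.

Definition corotational Omega : Prop :=
  forall F t, deformation_gradient F -> Omega F t \is skewmx.

(* Every pair (B, D) is attained at some time by some deformation gradient, e.g.
   t |-> exp(t D) sqrt(B) at t = 0, so the range of B and D is all of
   Sym++(3) x (Sym(3) \ {0}). *)
Definition positive_rate Omega : Prop :=
  forall (B D : 'M[R]_3), posdefmx B -> D \is symmetricmx -> D != 0 ->
  forall F t, deformation_gradient F ->
    left_cauchy_green F t = B -> stretching F t = D ->
    0 < inner (rate Omega F t) D.

End Kinematics.

(* Main.v *)
Require Import Defs.
From mathcomp Require Import all_boot all_order all_algebra.
From mathcomp Require Import complex.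
From mathcomp Require Import all_classical all_reals all_analysis.
From mathcomp Require Import ring.
Set Implicit Arguments.
Unset Strict Implicit.
Unset Printing Implicit Defensive.
Import Order.TTheory GRing.Theory Num.Theory.
Import numFieldNormedType.Exports.
Local Open Scope classical_set_scope.
Local Open Scope ring_scope.

(** Let V be the positive definite square root of B. By the spectral theorem
    the orthogonal eigenprojections P_mu of V add up to 1
    ([spectral_resolution]), so D is the sum of its blocks P_mu D P_nu. These
    blocks are mutually orthogonal for the trace inner product, left
    multiplication by B scales such a block by mu^2 and right multiplication
    by nu^2. Hence the operator A_g(B) is diagonal on the blocks and
<<
      < A_g(B).D, D > = sum over mu, nu of h(mu, nu) |P_mu D P_nu|^2,
      h(mu, nu) = mu^2 + nu^2 + [mu <> nu] g(mu, nu) (mu^2 - nu^2)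
>>
    ([inner_Aop]). Everything is then read off h ([spectral_coeff]). It is
    2 mu^2 on the diagonal, and off the diagonal it equals
    - mu^2 + nu^2 for Zaremba-Jaumann,
    - 2 mu nu for Green-Naghdi,
    - (mu^2 - nu^2) / (log mu - log nu) for the logarithmic rate, positive since
      the square and the logarithm are both increasing,
    - 0 for Gurtin-Spear.
    In the first three cases h is positive, so the quadratic form is positive
    definite ([Aop_positive_coeff]). In the last one the form vanishes on every
    D that only couples two different eigenspaces of V
    ([inner_Aop_GS_dyad]).

    For an actual motion, B' = L B + B L^T with L = D + W; the vorticity W
    cancels in the corotational rate, and the commutator of B with the
    remaining part of the spin is the sum in A_g(B).D ([rate_spin_of]). So the
    rate is A_g(B).D, and its positivity follows from that of A_g. The spin is
    skew because all four functions g are antisymmetric. To refute positivity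
    of the Gurtin-Spear rate itself one also needs a motion that reaches a
    degenerate pair (B, D); a polynomial one of constant determinant is given
    by [GS_motion]. *)

(** * Real symmetric matrices are diagonalizable *)

Lemma symmetricmx_tr (F : fieldType) n (A : 'M[F]_n) : A \is symmetricmx <-> A^T = A.
Proof.
split=> [/is_hermitianmxP|symA]; first by rewrite scale1r map_mx_id // => {2}->.
by apply/is_hermitianmxP; rewrite scale1r map_mx_id.
Qed.

Lemma skewmx_tr (F : fieldType) n (A : 'M[F]_n) : A \is skewmx <-> A^T = - A.
Proof.
split=> [/is_hermitianmxP|skewA].
  by rewrite expr1 scaleN1r map_mx_id // => {2}->; rewrite opprK.
by apply/is_hermitianmxP; rewrite expr1 scaleN1r map_mx_id // skewA opprK.
Qed.

(** Over the complexification the matrix is Hermitian, hence unitarily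
    diagonalizable with a real spectrum. Its minimal polynomial, which is the
    same over both fields, is therefore a product of distinct real linear
    factors. *)
Lemma symmetric_diagonalizable (R : rcfType) n (A : 'M[R]_n.+1) :
  A \is symmetricmx -> diagonalizable A.
Proof.
move=> /symmetricmx_tr symA; pose toC : {rmorphism R -> R[i]} := real_complex R.
pose AC := map_mx toC A; apply/diagonalizableP.
have hermA : AC \is hermsymmx.
  apply: realsym_hermsym; first by apply/symmetricmx_tr; rewrite /AC map_trmx symA.
  by apply/mxOverP => i j; rewrite mxE complex_real.
have /orthomx_spectralP AE := hermitian_normalmx hermA.
have realD := hermitian_spectral_diag_real hermA.
pose d i := complex.Re (spectral_diag AC 0 i).
have dE i : spectral_diag AC 0 i = toC (d i).
  by have /mxOverP/(_ 0 i)/Creal_ReP := realD; rewrite -complexRe.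
exists (undup [seq d i | i <- enum 'I_n.+1]); first exact: undup_uniq.
(* Divisibility of real polynomials may be tested over the complex numbers. *)
rewrite -(dvdp_map toC) -mxminpoly_map -/AC AE.
rewrite -conjVmx ?spectral_unit // mxminpoly_uconj ?unitmx_inv ?spectral_unit //.
rewrite mxminpoly_diag.
rewrite rmorph_prod /=.
rewrite (eq_map dE) map_comp undup_map_inj; last exact: complexI.
by rewrite big_map; under [X in _ %| X]eq_bigr do rewrite map_polyXsubC.
Qed.

(** * Orthogonal projections and the spectral resolution *)

Section OrthogonalProjection.
Context {R : realFieldType} {n : nat}.
Implicit Types (A W : 'M[R]_n) (u v : 'rV[R]_n).

Definition orthoproj A : 'M[R]_n := proj_mx A (orthomx idfun 1%:M A).

Lemma mx_inner_ge0 m p (X : 'M[R]_(m, p)) : 0 <= \tr (X *m X^T).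
Proof.
rewrite /mxtrace sumr_ge0 // => i _; rewrite mxE sumr_ge0 // => j _.
by rewrite mxE -expr2 sqr_ge0.
Qed.

Lemma mx_inner_eq0 m p (X : 'M[R]_(m, p)) : (\tr (X *m X^T) == 0) = (X == 0).
Proof.
apply/eqP/eqP => [trX0|->]; last by rewrite mul0mx mxtrace0.
apply/matrixP => i j; rewrite mxE; apply/eqP; rewrite -sqrf_eq0 expr2.
have ge0 k l : 0 <= X k l * X^T l k by rewrite mxE -expr2 sqr_ge0.
move: trX0; rewrite /mxtrace => /eqP; rewrite psumr_eq0; last first.
  by move=> k _; rewrite mxE sumr_ge0.
move=> /allP/(_ i); rewrite mem_index_enum => /(_ isT)/=.
rewrite mxE psumr_eq0 // => /allP/(_ j); rewrite mem_index_enum => /(_ isT)/=.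
by rewrite mxE.
Qed.

(** A real vector orthogonal to itself is zero: this is where the order on the
    scalars enters. The dimension count below then makes the two subspaces
    complementary. *)
Lemma cap_orthomx A : (A :&: orthomx idfun 1%:M A = 0)%MS.
Proof.
apply/eqP/rowV0P => v; rewrite sub_capmx => /andP[/submxP[w vE]].
rewrite sub_kermx mul1mx map_mx_id // => /eqP vA0.
apply/eqP; rewrite -mx_inner_eq0 {2}vE trmx_mul mulmxA vA0 mul0mx.
by rewrite mxtrace0.
Qed.

Lemma add_orthomx A : (1%:M <= A + orthomx idfun 1%:M A)%MS.
Proof.
rewrite sub1mx /row_full mxrank_disjoint_sum ?cap_orthomx // mxrank_ker.
by rewrite mul1mx map_mx_id // mxrank_tr subnKC ?rank_leq_col.
Qed.

Lemma orthoproj_sub A : (orthoproj A <= A)%MS.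
Proof. by rewrite -[orthoproj A]mul1mx proj_mx_sub. Qed.

Lemma orthoproj_id m A (W : 'M[R]_(m, n)) : (W <= A)%MS -> W *m orthoproj A = W.
Proof. by move=> WA; rewrite proj_mx_id ?cap_orthomx. Qed.

Lemma orthoproj_idem A : orthoproj A *m orthoproj A = orthoproj A.
Proof. exact/orthoproj_id/orthoproj_sub. Qed.

(** The rows of 1 - P lie in the orthogonal complement and those of P in A,
    so (1 - P) P^T = 0, that is P^T = P P^T, which is a symmetric matrix. *)
Lemma tr_orthoproj A : (orthoproj A)^T = orthoproj A.
Proof.
set P := orthoproj A; suff PPT : P^T = P *m P^T.
  move: PPT; move: P => P PPT; rewrite PPT.
  by have := congr1 trmx PPT; rewrite trmx_mul !trmxK => <-.
have /submxP[X PX] := orthoproj_sub A; rewrite -/P in PX.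
have := proj_mx_compl_sub (add_orthomx A).
rewrite mul1mx -/(orthoproj A) -/P sub_kermx mul1mx map_mx_id // => /eqP cA0.
apply/eqP; rewrite -subr_eq0 -{1}[P^T]mul1mx -mulmxBl {2}PX trmx_mul mulmxA.
by rewrite cA0 mul0mx.
Qed.

End OrthogonalProjection.

Section SpectralResolution.
Context {R : realType}.
Implicit Types (B D V : 'M[R]_3) (g : R -> R -> R) (mu nu : R).

Lemma tr_eigenproj V mu : (eigenproj V mu)^T = eigenproj V mu.
Proof. exact: tr_orthoproj. Qed.

Lemma eigenproj_idem V mu : eigenproj V mu *m eigenproj V mu = eigenproj V mu.
Proof. exact: orthoproj_idem. Qed.

Lemma eigenproj_mull V mu : eigenproj V mu *m V = mu *: eigenproj V mu.
Proof. exact/eigenspaceP/orthoproj_sub. Qed.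

Lemma eigenproj_id m V mu (W : 'M[R]_(m, 3)) :
  W *m V = mu *: W -> W *m eigenproj V mu = W.
Proof. by move=> /eigenspaceP; apply: orthoproj_id. Qed.

Section Symmetric.
Variable V : 'M[R]_3.
Hypothesis symV : V^T = V.

Lemma eigenproj_mulr mu : V *m eigenproj V mu = mu *: eigenproj V mu.
Proof.
by rewrite -{1}symV -tr_eigenproj -trmx_mul eigenproj_mull linearZ.
Qed.

(** Evaluating P_mu V P_nu from both sides gives mu P_mu P_nu = nu P_mu P_nu. *)
Lemma eigenproj_orth mu nu :
  mu != nu -> eigenproj V mu *m eigenproj V nu = 0.
Proof.
move=> neq; apply/eqP; set X := _ *m _.
have : mu *: X == nu *: X.
  by rewrite scalemxAl -eigenproj_mull -mulmxA eigenproj_mulr -scalemxAr.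
by rewrite -subr_eq0 -scalerBl scaler_eq0 subr_eq0 (negPf neq).
Qed.

Lemma eigenproj_orthv m mu nu (W : 'M[R]_(m, 3)) :
  W *m V = mu *: W -> mu != nu -> W *m eigenproj V nu = 0.
Proof.
move=> /eigenproj_id <- neq.
by rewrite -mulmxA eigenproj_orth // mulmx0.
Qed.

(** Diagonalizability says that the eigenspaces span; the matrix
    (sum of the P_mu) - 1 kills each of them, hence is zero. *)
Lemma spectral_resolution : exists rs : seq R,
  [/\ uniq rs, forall mu, (mu \in rs) = eigenvalue V mu
    & \sum_(mu <- rs) eigenproj V mu = 1%:M].
Proof.
have [rs0 urs0 full] : exists2 rs, uniq rs &
    (\sum_(mu <- rs) eigenspace V mu :=: 1%:M)%MS.
  exact/diagonalizablePeigen/symmetric_diagonalizable/symmetricmx_tr.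
have sum1 : \sum_(mu <- rs0) eigenproj V mu = 1%:M.
  apply/eqP; rewrite -subr_eq0 -[X in X == _]mul1mx -sub_kermx -full big_seq.
  apply: (big_ind (fun A : 'M[R]_3 => A <= kermx _)%MS) => [|A B AK BK|mu mu_rs].
  - exact: sub0mx.
  - by rewrite addsmx_sub AK BK.
  rewrite sub_kermx mulmxBr mulmx1 mulmx_sumr (bigD1_seq mu) //=.
  have /eigenspaceP eig := submx_refl (eigenspace V mu).
  rewrite (eigenproj_id eig) big1 ?addr0 ?subrr // => nu neq.
  by rewrite (eigenproj_orthv eig) // eq_sym.
have P0 mu : ~~ eigenvalue V mu -> eigenproj V mu = 0.
  rewrite negbK => /eqP E0; apply/eqP.
  by rewrite -submx0 -E0; apply: orthoproj_sub.
(* rs0 may contain reals that are not eigenvalues; their projections are 0. *)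
exists [seq mu <- rs0 | eigenvalue V mu]; split; first exact: filter_uniq.
  move=> mu; rewrite mem_filter andb_idr // => /eigenvalueP[v vV v0].
  apply: contraNT v0 => mu_rs; rewrite -[v]mulmx1 -sum1 mulmx_sumr big_seq.
  rewrite big1 // => nu nu_rs; apply: (eigenproj_orthv vV).
  by apply: contraNneq mu_rs => ->.
rewrite big_filter -[RHS]sum1 big_mkcond; apply: eq_bigr => mu _.
by case: ifPn => // /P0.
Qed.

End Symmetric.
End SpectralResolution.

(** * The square root and the block-diagonal form of A_g *)

Section SpectralForm.
Context {R : realType}.
Implicit Types (B D V X Y : 'M[R]_3) (g : R -> R -> R) (mu nu : R).

Lemma posdefmx_tr V : posdefmx V -> V^T = V.
Proof. by case=> /symmetricmx_tr. Qed.

Lemma posdefmx_eigenvalue V mu : posdefmx V -> eigenvalue V mu -> 0 < mu.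
Proof.
move=> [_ posV] /eigenvalueP[v vV v0].
have : v^T != 0 by rewrite -(inj_eq (@trmx_inj _ _ _)) trmx0 trmxK.
move=> /posV; rewrite trmxK vV -scalemxAl mxE -trace_mx11.
by rewrite pmulr_lgt0 // lt0r mx_inner_eq0 v0 mx_inner_ge0.
Qed.

(** Two-sided compression by orthogonal projections is an orthogonal projection
    of the space of matrices: <P X Q, X> = |P X Q|^2. *)
Lemma tr_sandwich m n (P : 'M[R]_m) (Q : 'M[R]_n) (X : 'M[R]_(m, n)) :
  P^T = P -> P *m P = P -> Q^T = Q -> Q *m Q = Q ->
  \tr (P *m X *m Q *m X^T) = \tr ((P *m X *m Q) *m (P *m X *m Q)^T).
Proof.
move=> symP PP symQ QQ; rewrite !trmx_mul symP symQ -!mulmxA (mulmxA Q Q) QQ.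
by rewrite -[in LHS]PP -!mulmxA mxtrace_mulC -!mulmxA.
Qed.

(** The witness is the sum of the sqrt(mu) P_mu over the spectrum of B; its
    quadratic form at v is the sum of the sqrt(mu) |P_mu v|^2. *)
Lemma sqrtmxP B : posdefmx B -> posdefmx (sqrtmx B) /\ sqrtmx B *m sqrtmx B = B.
Proof.
move=> posB; have symB := posdefmx_tr posB.
suff ex : [set V | posdefmx V /\ V *m V = B] !=set0 by exact: (xgetPex 0 ex).
have [rs [urs mem_rs sum1]] := spectral_resolution symB.
have rs_gt0 mu : mu \in rs -> 0 < mu.
  by rewrite mem_rs; apply: posdefmx_eigenvalue.
pose V := \sum_(mu <- rs) Num.sqrt mu *: eigenproj B mu.
have PV mu : mu \in rs -> eigenproj B mu *m V = Num.sqrt mu *: eigenproj B mu.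
  move=> mu_rs; rewrite mulmx_sumr (bigD1_seq mu) //= -scalemxAr.
  rewrite eigenproj_idem big1 ?addr0 // => nu neq.
  by rewrite -scalemxAr eigenproj_orth ?scaler0 // eq_sym.
exists V; split; last first.
  rewrite -[RHS]mul1mx -sum1 mulmx_suml {1}/V mulmx_suml.
  rewrite [LHS]big_seq [RHS]big_seq; apply: eq_bigr => mu mu_rs.
  rewrite -scalemxAl PV // scalerA -expr2 sqr_sqrtr ?eigenproj_mull //.
  exact/ltW/rs_gt0.
split.
  apply/symmetricmx_tr; rewrite linear_sum; apply: eq_bigr => mu _.
  by rewrite linearZ /= tr_eigenproj.
move=> v v0.
pose q mu := \tr ((v^T *m eigenproj B mu) *m (v^T *m eigenproj B mu)^T).
have -> : (v^T *m V *m v) 0 0 = \sum_(mu <- rs) Num.sqrt mu * q mu.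
  rewrite -trace_mx11 mulmx_sumr mulmx_suml linear_sum; apply: eq_bigr => mu _.
  rewrite -scalemxAr -scalemxAl linearZ /= /q; congr (_ * _).
  have := tr_sandwich v^T (trmx1 _ _) (mul1mx _)
            (tr_eigenproj B mu) (eigenproj_idem B mu).
  by rewrite !mul1mx trmxK.
have ge0 mu : 0 <= Num.sqrt mu * q mu by rewrite mulr_ge0 ?sqrtr_ge0 ?mx_inner_ge0.
rewrite lt0r sumr_ge0 ?andbT //; apply: contraNneq v0 => /eqP.
rewrite psumr_eq0 // => /allP q0; rewrite -[v]trmxK -[v^T]mulmx1 -sum1.
rewrite mulmx_sumr big_seq big1 ?trmx0 // => mu mu_rs; apply/eqP.
have := q0 _ mu_rs; rewrite /= mulf_eq0 sqrtr_eq0 leNgt rs_gt0 //=.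
by rewrite mx_inner_eq0.
Qed.

Lemma sum_distinct_eigenpairs V (rs : seq R) (W : zmodType) (f : R * R -> W) :
  uniq rs -> (forall mu, (mu \in rs) = eigenvalue V mu) ->
  \sum_(p \in distinct_eigenpairs V) f p =
  \sum_(mu <- rs) \sum_(nu <- rs | mu != nu) f (mu, nu).
Proof.
move=> urs mem_rs.
pose prs := [seq p <- [seq (mu, nu) | mu <- rs, nu <- rs] | p.1 != p.2].
have -> : distinct_eigenpairs V = [set` prs].
  apply/seteqP; split=> -[mu nu] /=.
    move=> -[]; rewrite /= -!mem_rs => mu_rs nu_rs neq.
    rewrite mem_filter /= neq /=; apply/allpairsP.
    by exists (mu, nu).
  rewrite mem_filter /= => /andP[neq /allpairsP[[a b] [/= a_rs b_rs [Ea Eb]]]].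
  by move: a_rs b_rs neq; rewrite -Ea -Eb !mem_rs.
have uprs : uniq prs by rewrite filter_uniq // allpairs_uniq // => -[a b] [c d].
rewrite -(@fsbig_seq _ 0 +%R _ prs f uprs).
by rewrite big_filter big_mkcond big_allpairs; apply: eq_bigr => mu _;
  rewrite -big_mkcond.
Qed.

(** The eigenvalue of the operator [Aop g B] on the block P_mu D P_nu, where mu
    and nu are eigenvalues of the square root of B. *)
Definition spectral_coeff g mu nu : R :=
  mu ^+ 2 + nu ^+ 2 + (if mu != nu then g mu nu * (mu ^+ 2 - nu ^+ 2) else 0).

Lemma sandwich_decomp (rs : seq R) (P : R -> 'M[R]_3) D :
  \sum_(mu <- rs) P mu = 1%:M ->
  D = \sum_(mu <- rs) \sum_(nu <- rs) P mu *m D *m P nu.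
Proof.
move=> sum1; rewrite -[LHS]mul1mx -{1}sum1 mulmx_suml; apply: eq_bigr => mu _.
by rewrite -[LHS]mulmx1 -{1}sum1 mulmx_sumr.
Qed.

(** Blocks are eigenvectors of left and right multiplication by B = V^2. *)
Lemma eigenproj_sandwich V mu nu D (X := eigenproj V mu *m D *m eigenproj V nu) :
  V^T = V ->
  V *m V *m X = mu ^+ 2 *: X /\ X *m (V *m V) = nu ^+ 2 *: X.
Proof.
move=> symV; have VX : V *m X = mu *: X.
  by rewrite /X 2!(mulmxA V) eigenproj_mulr // -!scalemxAl.
have XV : X *m V = nu *: X by rewrite /X -mulmxA eigenproj_mull -scalemxAr.
move: X VX XV => X VX XV; split.
  by rewrite -mulmxA VX -scalemxAr VX scalerA -expr2.
by rewrite mulmxA XV -scalemxAl XV scalerA -expr2.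
Qed.

Lemma Aop_spectral g B D (rs : seq R) (V := sqrtmx B) : posdefmx B ->
  uniq rs -> (forall mu, (mu \in rs) = eigenvalue V mu) ->
  \sum_(mu <- rs) eigenproj V mu = 1%:M ->
  Aop g B D = \sum_(mu <- rs) \sum_(nu <- rs)
    spectral_coeff g mu nu *: (eigenproj V mu *m D *m eigenproj V nu).
Proof.
move=> posB urs mem_rs sum1; have [posV VV] := sqrtmxP posB.
have symV := posdefmx_tr posV.
have DE := sandwich_decomp D sum1.
rewrite /Aop (sum_distinct_eigenpairs _ urs mem_rs) /=.
rewrite {1 2}DE mulmx_sumr mulmx_suml -!big_split /=; apply: eq_bigr => mu _.
rewrite mulmx_sumr mulmx_suml [X in _ + X]big_mkcond -!big_split /=.
apply: eq_bigr => nu _; have := eigenproj_sandwich mu nu D symV.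
rewrite /= VV => -[-> ->].
rewrite /spectral_coeff !scalerDl.
by case: ifP => _; rewrite ?scale0r.
Qed.

Lemma inner_Aop g B D (rs : seq R) (V := sqrtmx B) : posdefmx B ->
  uniq rs -> (forall mu, (mu \in rs) = eigenvalue V mu) ->
  \sum_(mu <- rs) eigenproj V mu = 1%:M ->
  inner (Aop g B D) D = \sum_(mu <- rs) \sum_(nu <- rs)
    spectral_coeff g mu nu *
      inner (eigenproj V mu *m D *m eigenproj V nu)
            (eigenproj V mu *m D *m eigenproj V nu).
Proof.
move=> posB urs mem_rs sum1; rewrite (Aop_spectral _ _ posB urs mem_rs sum1).
rewrite /inner mulmx_suml linear_sum; apply: eq_bigr => mu _.
rewrite mulmx_suml linear_sum; apply: eq_bigr => nu _.
rewrite -scalemxAl linearZ /=; congr (_ * _).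
by apply: tr_sandwich; rewrite ?tr_eigenproj ?eigenproj_idem.
Qed.

(** A sum of nonnegative terms that is not positive has only zero terms, so all
    blocks of D vanish, and D with them. *)
Lemma Aop_positive_coeff g :
  (forall mu nu, 0 < mu -> 0 < nu -> 0 < spectral_coeff g mu nu) ->
  Aop_positive g.
Proof.
move=> coeff_gt0 B D posB _; apply: contraNT => le0.
have [posV _] := sqrtmxP posB.
have [rs [urs mem_rs sum1]] := spectral_resolution (posdefmx_tr posV).
have rs_gt0 mu : mu \in rs -> 0 < mu.
  by rewrite mem_rs; apply: posdefmx_eigenvalue.
have ge0 mu nu : mu \in rs -> nu \in rs -> 0 <= spectral_coeff g mu nu *
    inner (eigenproj (sqrtmx B) mu *m D *m eigenproj (sqrtmx B) nu)
          (eigenproj (sqrtmx B) mu *m D *m eigenproj (sqrtmx B) nu).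
  move=> mu_rs nu_rs; rewrite mulr_ge0 ?mx_inner_ge0 //.
  by rewrite ltW // coeff_gt0 ?rs_gt0.
move: le0; rewrite (inner_Aop _ _ posB urs mem_rs sum1) big_seq.
rewrite lt0r sumr_ge0 ?andbT; last first.
  by move=> mu mu_rs; rewrite big_seq sumr_ge0 // => nu; apply: ge0.
rewrite negbK psumr_eq0; last first.
  by move=> mu mu_rs; rewrite big_seq sumr_ge0 // => nu; apply: ge0.
move=> /allP all0; rewrite (sandwich_decomp D sum1) big_seq big1 // => mu mu_rs.
have := all0 _ mu_rs; rewrite mu_rs /= big_seq psumr_eq0; last first.
  by move=> nu; apply: ge0.
move=> /allP {}all0; rewrite big_seq big1 // => nu nu_rs; apply/eqP.
have := all0 _ nu_rs; rewrite nu_rs /= mulf_eq0 gt_eqF ?coeff_gt0 ?rs_gt0 //=.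
by rewrite mx_inner_eq0.
Qed.

End SpectralForm.

(** * The four coefficient functions *)

Section Coefficients.
Context {R : realType}.
Implicit Types mu nu : R.

Lemma spectral_coeff_ZJ mu nu : 0 < mu -> 0 < nu -> 0 < spectral_coeff gZJ mu nu.
Proof.
move=> mu0 nu0; rewrite /spectral_coeff /gZJ mul0r if_same addr0.
by rewrite addr_gt0 ?exprn_gt0.
Qed.

Lemma spectral_coeff_GN mu nu : 0 < mu -> 0 < nu -> 0 < spectral_coeff gGN mu nu.
Proof.
move=> mu0 nu0; rewrite /spectral_coeff /gGN; case: ifP => _.
  have s0 : mu + nu != 0 by rewrite gt_eqF ?addr_gt0.
  rewrite [ltRHS](_ : _ = 2 * (mu * nu)) ?mulr_gt0 //.
  by field.
by rewrite addr0 addr_gt0 ?exprn_gt0.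
Qed.

(** The Gurtin-Spear function is chosen exactly so as to cancel the off-diagonal
    part of D |-> B D + D B; the logarithmic one is this plus a correction. *)
Lemma gGS_cancel mu nu : 0 < mu -> 0 < nu -> mu != nu ->
  gGS mu nu * (mu ^+ 2 - nu ^+ 2) = - (mu ^+ 2 + nu ^+ 2).
Proof.
move=> mu0 nu0 neq; have : nu ^+ 2 - mu ^+ 2 != 0.
  by rewrite subr_eq0 eqrXn2 ?ltW // eq_sym.
by rewrite /gGS => ?; field.
Qed.

Lemma spectral_coeff_log mu nu : 0 < mu -> 0 < nu -> 0 < spectral_coeff glog mu nu.
Proof.
move=> mu0 nu0; rewrite /spectral_coeff; case: ifPn => [neq|_]; last first.
  by rewrite addr0 addr_gt0 ?exprn_gt0.
rewrite /glog -/(gGS mu nu) mulrDl gGS_cancel // addrA subrr add0r div1r.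
(* The remaining quotient is symmetric in mu and nu. *)
wlog lt : mu nu mu0 nu0 neq / mu < nu => [hwlog|].
  have [lt|lt|eq] := ltgtP mu nu; first exact: hwlog.
    have := hwlog nu mu nu0 mu0; rewrite eq_sym => /(_ neq lt).
    by rewrite -(opprB (ln mu)) -(opprB (mu ^+ 2)) invrN mulrNN.
  by rewrite eq eqxx in neq.
rewrite nmulr_rgt0 ?invr_lt0 ?subr_lt0 ?ltr_ln //.
by rewrite ltrXn2r ?ltW.
Qed.

Lemma spectral_coeff_GS mu nu : 0 < mu -> 0 < nu -> mu != nu ->
  spectral_coeff gGS mu nu = 0.
Proof. by move=> mu0 nu0 neq; rewrite /spectral_coeff neq gGS_cancel ?subrr. Qed.

Lemma gZJ_anti mu nu : gZJ nu mu = - gZJ mu nu :> R.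
Proof. by rewrite /gZJ oppr0. Qed.

Lemma gGN_anti mu nu : gGN nu mu = - gGN mu nu.
Proof. by rewrite /gGN -mulNr opprB (addrC nu). Qed.

Lemma gGS_anti mu nu : gGS nu mu = - gGS mu nu.
Proof. by rewrite /gGS addrC -(opprB (nu ^+ 2)) invrN mulrN. Qed.

Lemma glog_anti mu nu : glog nu mu = - glog mu nu.
Proof.
rewrite /glog -/(gGS nu mu) -/(gGS mu nu) gGS_anti opprD; congr (_ + _).
by rewrite -(opprB (ln mu)) invrN mulrN.
Qed.

End Coefficients.

Section GurtinSpear.
Context {R : realType}.

(** Let V be the square root. Then w = v V - c v satisfies w V = - c w; as V has
    no negative eigenvalue, w = 0. This gives what is needed of the square root without
    computing it. *)
Lemma sqrtmx_eigenvector (B : 'M[R]_3) (v : 'rV[R]_3) (c : R) :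
  posdefmx B -> 0 < c -> v *m B = c ^+ 2 *: v -> v *m sqrtmx B = c *: v.
Proof.
move=> posB c0 vB; have [posV VV] := sqrtmxP posB.
move: (sqrtmx B) posV VV => V posV VV; apply/eqP; rewrite -subr_eq0.
have [//|w0] := eqVneq (v *m V - c *: v) 0.
suff /(posdefmx_eigenvalue posV) : eigenvalue V (- c) by rewrite oppr_gt0 ltNge ltW.
apply/eigenvalueP; exists (v *m V - c *: v) => //.
rewrite mulmxBl -mulmxA VV vB -scalemxAl scalerBr !scaleNr scalerA opprK -expr2.
by rewrite addrC.
Qed.

(** Off-diagonal blocks do not contribute since their coefficient is 0, and
    D has no diagonal block: each P_mu annihilates u or v, these being
    eigenvectors of the square root of B for different eigenvalues. *)
Lemma inner_Aop_GS_dyad (B : 'M[R]_3) (u v : 'rV[R]_3) (a b : R)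
    (D := u^T *m v + v^T *m u) :
  posdefmx B -> 0 < a -> 0 < b -> a != b ->
  u *m B = a ^+ 2 *: u -> v *m B = b ^+ 2 *: v ->
  inner (Aop gGS B D) D = 0.
Proof.
move=> posB a0 b0 ab uB vB; have [posV _] := sqrtmxP posB.
have symV := posdefmx_tr posV.
have [rs [urs mem_rs sum1]] := spectral_resolution symV.
rewrite (inner_Aop _ _ posB urs mem_rs sum1).
rewrite big_seq big1 // => mu; rewrite mem_rs => /(posdefmx_eigenvalue posV) mu0.
rewrite big_seq big1 // => nu; rewrite mem_rs => /(posdefmx_eigenvalue posV) nu0.
have [<-|neq] := eqVneq mu nu; last by rewrite spectral_coeff_GS ?mul0r.
have uV := sqrtmx_eigenvector posB a0 uB.
have vV := sqrtmx_eigenvector posB b0 vB.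
suff -> : eigenproj (sqrtmx B) mu *m D *m eigenproj (sqrtmx B) mu = 0.
  by rewrite /inner mul0mx mxtrace0 mulr0.
have PDP (x y : 'rV[R]_3) : x *m eigenproj (sqrtmx B) mu = 0 \/
    y *m eigenproj (sqrtmx B) mu = 0 ->
    eigenproj (sqrtmx B) mu *m (x^T *m y) *m eigenproj (sqrtmx B) mu = 0.
  move=> xy; rewrite -(mulmxA _ (x^T *m y)) -(mulmxA x^T).
  case: xy => [x0|->]; last by rewrite !mulmx0.
  by rewrite (mulmxA _ x^T) -[X in X *m x^T]tr_eigenproj -trmx_mul x0 trmx0 mul0mx.
have kill : u *m eigenproj (sqrtmx B) mu = 0 \/ v *m eigenproj (sqrtmx B) mu = 0.
  have [amu|neq] := eqVneq a mu; [right|left].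
    by apply: (eigenproj_orthv symV vV); rewrite -amu eq_sym.
  exact: (eigenproj_orthv symV uV).
by rewrite mulmxDr mulmxDl !PDP ?addr0 //; case: kill; by [left|right].
Qed.

End GurtinSpear.

(** * The corotational rate along a motion *)

Section Kinematics.
Context {R : realType}.
Implicit Types (F : R -> 'M[R]_3) (t : R) (g : R -> R -> R).

Lemma is_derive_mxP F t (dF : 'M[R]_3) :
  is_derive t 1 F dF <-> forall i j, is_derive t 1 (fun x => F x i j) (dF i j).
Proof.
split=> [[dFt <-] i j|dFt].
  have /derivable_mxP dFij := dFt.
  by apply: DeriveDef => //; rewrite derive_mx // mxE.
have dF1 : derivable F t 1 by apply/derivable_mxP => i j; case: (dFt i j).
apply: DeriveDef => //; rewrite derive_mx //; apply/matrixP => i j.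
by rewrite mxE; case: (dFt i j).
Qed.

(** The product rule, applied to the scalar entries. *)
Lemma derive1_left_cauchy_green F t : derivable F t 1 ->
  derive1 (left_cauchy_green F) t =
  derive1 F t *m (F t)^T + F t *m (derive1 F t)^T.
Proof.
move=> dF; rewrite !derive1E.
have /is_derive_mxP dFij : is_derive t 1 F ('D_1 F t) by exact: DeriveDef.
suff /is_derive_mxP : forall i j, is_derive t 1 (fun x => left_cauchy_green F x i j)
    (('D_1 F t *m (F t)^T + F t *m ('D_1 F t)^T) i j) by case.
move=> i j.
have -> : (fun x => left_cauchy_green F x i j) =
    \sum_(k < 3) ((fun x => F x i k) * (fun x => F x j k)).
  apply/funext => x; rewrite fct_sumE mxE; apply: eq_bigr => k _.
  by rewrite mxE.
have -> : ('D_1 F t *m (F t)^T + F t *m ('D_1 F t)^T) i j =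
    \sum_(k < 3) (F t i k *: 'D_1 F t j k + F t j k *: 'D_1 F t i k).
  rewrite !mxE -big_split; apply: eq_bigr => k _ /=.
  by rewrite !mxE addrC; congr (_ + _); rewrite mulrC.
by apply: is_derive_sum => k; apply: is_deriveM.
Qed.

Lemma deformation_gradient_unit F t : deformation_gradient F -> F t \in unitmx.
Proof. by move=> /(_ t)[_ det0]; rewrite unitmxE unitfE gt_eqF. Qed.

(** The quadratic form of A A^T at v is |v^T A|^2. *)
Lemma posdefmx_gram (A : 'M[R]_3) : A \in unitmx -> posdefmx (A *m A^T).
Proof.
move=> unitA; split; first by apply/symmetricmx_tr; rewrite trmx_mul trmxK.
move=> v v0; rewrite mulmxA -(mulmxA _ A^T).
rewrite -[X in _ *m X]trmxK trmx_mul trmxK -trace_mx11 lt0r mx_inner_ge0 andbT.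
rewrite mx_inner_eq0; apply: contraNneq v0 => /(congr1 (mulmx^~ (invmx A))).
by rewrite mulmxK // mul0mx => /(congr1 trmx); rewrite trmxK trmx0 => ->.
Qed.

Lemma tr_stretching F t : (stretching F t)^T = stretching F t.
Proof. by rewrite linearZ /= linearD /= trmxK addrC. Qed.

Lemma tr_vorticity F t : (vorticity F t)^T = - vorticity F t.
Proof. by rewrite linearZ /= linearB /= trmxK -scalerN opprB. Qed.

Lemma velocity_gradientE F t :
  velocity_gradient F t = stretching F t + vorticity F t.
Proof.
rewrite /stretching /vorticity; move: (velocity_gradient F t) => L.
by apply/matrixP => i j; rewrite !mxE; field.
Qed.

(** Transposition exchanges P_mu D P_nu with P_nu D P_mu. *)
Lemma spin_sum_skew g V D : V^T = V -> D^T = D ->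
  (forall mu nu, g nu mu = - g mu nu) ->
  (spin_sum g V D)^T = - spin_sum g V D.
Proof.
move=> symV symD g_anti.
have [rs [urs mem_rs _]] := spectral_resolution symV.
rewrite /spin_sum (sum_distinct_eigenpairs _ urs mem_rs) /=.
rewrite linear_sum /=; under eq_bigr do rewrite linear_sum /=.
rewrite (exchange_big_dep xpredT) //= -sumrN; apply: eq_bigr => mu _.
rewrite -sumrN; apply: eq_big => [nu|nu _]; first by rewrite eq_sym.
rewrite linearZ /= g_anti scaleNr trmx_mul [X in _ *m X]trmx_mul.
by rewrite !tr_eigenproj symD mulmxA.
Qed.

Lemma corotational_spin_of g :
  (forall mu nu, g nu mu = - g mu nu) -> corotational (spin_of g : spin_law).
Proof.
move=> g_anti F t defF; apply/skewmx_tr; rewrite /spin_of linearD /= tr_vorticity.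
rewrite spin_sum_skew ?tr_stretching //; first by rewrite opprD.
have /sqrtmxP[posV _] := posdefmx_gram (deformation_gradient_unit t defF).
exact: posdefmx_tr.
Qed.

(** On the block P_mu D P_nu, commutation with B multiplies by mu^2 - nu^2. *)
Lemma spin_sum_commutator g B D (S := spin_sum g (sqrtmx B) D) : posdefmx B ->
  B *m D + D *m B - S *m B + B *m S = Aop g B D.
Proof.
move=> posB; have [posV VV] := sqrtmxP posB.
have symV := posdefmx_tr posV.
have [rs [urs mem_rs _]] := spectral_resolution symV.
rewrite /S /Aop /spin_sum -!addrA; congr (_ + (_ + _)).
rewrite !(sum_distinct_eigenpairs _ urs mem_rs) /=.
rewrite mulmx_suml mulmx_sumr -sumrN -big_split; apply: eq_bigr => mu _ /=.
rewrite mulmx_suml mulmx_sumr -sumrN -big_split; apply: eq_bigr => nu _ /=.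
have := eigenproj_sandwich mu nu D symV; rewrite /= VV => -[BX XB].
rewrite -scalemxAl -scalemxAr BX XB !scalerA -scaleNr -scalerDl.
by congr (_ *: _); ring.
Qed.

(** With L = D + W one has B' = L B + B L^T = D B + B D + W B - B W, and the
    vorticity part of the spin removes the last two terms. *)
Lemma rate_spin_of g F t : deformation_gradient F ->
  rate (spin_of g) F t = Aop g (left_cauchy_green F t) (stretching F t).
Proof.
move=> defF; have unitF := deformation_gradient_unit t defF.
rewrite -spin_sum_commutator; last exact: posdefmx_gram.
rewrite /rate derive1_left_cauchy_green; last by have [] := defF t.
have -> : derive1 F t = velocity_gradient F t *m F t by rewrite mulmxKV.
rewrite trmx_mul mulmxA -mulmxA -/(left_cauchy_green F t) velocity_gradientE.
rewrite linearD /= tr_stretching tr_vorticity /spin_of.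
move: (spin_sum _ _ _) => S.
rewrite !(mulmxDl, mulmxDr, mulmxN).
rewrite -!(mulmxA _ (F t)) !(mulmxA (F t)) -/(left_cauchy_green F t).
move: (left_cauchy_green F t) (stretching F t) (vorticity F t) => B D W.
move: (B *m D) (D *m B) (B *m W) (W *m B) (B *m S) (S *m B) => BD DB BW WB BS SB.
by apply/matrixP => i j; rewrite !mxE; ring.
Qed.

End Kinematics.

(** * A motion on which the Gurtin-Spear rate degenerates *)

Section GurtinSpearMotion.
Context {R : realType}.

Definition GS_stretch : 'M[R]_3 := diag_mx (\row_i (if i == 0 then 1 else 2)).

Definition GS_shear (t : R) : 'M[R]_3 := 1%:M + t *: delta_mx 1 0.

(** A shear times its transpose has determinant 1 for all t, and equals
    1 + t (E_01 + E_10) + t^2 E_11. So the motion stays invertible, has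
    stretching E_01 + E_10 at t = 0, and starts from the stretch diag(1, 2, 2). *)
Definition GS_motion (t : R) : 'M[R]_3 :=
  GS_shear t *m (GS_shear t)^T *m GS_stretch.

(** The matrix E_01 + E_10, written as a symmetrized dyad of eigenvectors of
    the stretch. *)
Definition GS_stretching : 'M[R]_3 :=
  (delta_mx 0 0 : 'rV[R]_3)^T *m delta_mx 0 1 +
  (delta_mx 0 1 : 'rV[R]_3)^T *m delta_mx 0 0.

Lemma GS_stretchingE : GS_stretching = delta_mx 0 1 + delta_mx 1 0.
Proof. by rewrite /GS_stretching !trmx_delta !mul_delta_mx. Qed.

Lemma GS_motionE t : GS_motion t =
  GS_stretch + t *: (GS_stretching *m GS_stretch)
  + t ^+ 2 *: (delta_mx 1 1 *m GS_stretch).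
Proof.
rewrite /GS_motion; move: GS_stretch => V.
rewrite !scalemxAl -{2}[V]mul1mx -!mulmxDl; congr (_ *m _).
rewrite GS_stretchingE /GS_shear linearD /= linearZ /= trmx1 trmx_delta.
rewrite mulmxDl !mulmxDr !mul1mx mulmx1 -scalemxAl -scalemxAr mul_delta_mx scalerA.
by rewrite scalerDr !addrA -expr2.
Qed.

Lemma det_GS_motion t : \det (GS_motion t) = 4.
Proof.
have det1 : \det (GS_shear t) = 1.
  rewrite det_trig; last first.
    apply/is_trig_mxP => i j lt_ij; rewrite !mxE.
    have -> : (i == j) = false by apply: contraTF lt_ij => /eqP->; rewrite ltnn.
    have -> : (i == 1) && (j == 0) = false.
      by apply: contraTF lt_ij => /andP[_ /eqP->]; rewrite ltn0.
    by rewrite mulr0 addr0.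
  rewrite big1 // => i _; rewrite !mxE eqxx.
  have -> : (i == 1) && (i == 0) = false by case: i => -[|[|[|]]].
  by rewrite mulr0 addr0.
rewrite !det_mulmx det_tr det1 !mul1r det_diag !big_ord_recl big_ord0 !mxE /=.
by ring.
Qed.

(** The entries of the motion are polynomials in t. *)
Lemma is_derive_GS_motion (t : R) :
  is_derive t (1 : R) GS_motion
    (GS_stretching *m GS_stretch + (2 * t) *: (delta_mx 1 1 *m GS_stretch)).
Proof.
apply/is_derive_mxP => i j.
pose p : {poly R} := (GS_stretch i j)%:P + ((GS_stretching *m GS_stretch) i j) *: 'X
  + ((delta_mx 1 1 *m GS_stretch) i j) *: 'X^2.
have -> : (fun x => GS_motion x i j) = horner p.
  apply/funext => x; rewrite GS_motionE /p.
  move: GS_stretch (GS_stretching *m _) (delta_mx 1 1 *m _) => V X Y.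
  by rewrite !mxE !(hornerD, hornerZ, hornerC, hornerX, hornerXn); ring.
have -> : (GS_stretching *m GS_stretch + (2 * t) *: (delta_mx 1 1 *m GS_stretch)) i j
    = (deriv p).[t].
  rewrite /p; move: GS_stretch (GS_stretching *m _) (delta_mx 1 1 *m _) => V X Y.
  rewrite !mxE !(derivD, derivZ, derivC, derivX, derivXn).
  rewrite !(hornerD, hornerZ, hornerC, hornerX, hornerMn); ring.
exact: is_derive_poly.
Qed.

Lemma GS_degenerate : exists F : R -> 'M[R]_3, exists D : 'M[R]_3,
  [/\ deformation_gradient F, D \is symmetricmx, D != 0, stretching F 0 = D
    & inner (Aop gGS (left_cauchy_green F 0) D) D = 0].
Proof.
have F0 : GS_motion 0 = GS_stretch by rewrite GS_motionE expr0n !scale0r !addr0.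
have symD : GS_stretching^T = GS_stretching.
  by rewrite GS_stretchingE linearD /= !trmx_delta addrC.
have defF : deformation_gradient GS_motion.
  by move=> t; rewrite det_GS_motion ltr0n; have [] := is_derive_GS_motion t.
have unitV : GS_stretch \in unitmx.
  by rewrite -F0; apply: deformation_gradient_unit.
exists GS_motion, GS_stretching; split=> //.
- exact/symmetricmx_tr.
- apply/eqP => /matrixP/(_ 0 1); rewrite GS_stretchingE !mxE /= addr0 => /eqP.
  by rewrite oner_eq0.
- rewrite /stretching; have -> : velocity_gradient GS_motion 0 = GS_stretching.
    rewrite /velocity_gradient F0 derive1E; have [_ ->] := is_derive_GS_motion 0.
    by rewrite mulr0 scale0r addr0 mulmxK.
  by rewrite symD; apply/matrixP => i j; rewrite !mxE; field.
have BE : left_cauchy_green GS_motion 0 = GS_stretch *m GS_stretch.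
  by rewrite /left_cauchy_green F0 tr_diag_mx.
have row_B i : (delta_mx 0 i : 'rV[R]_3) *m left_cauchy_green GS_motion 0 =
    (if i == 0 then 1 else 2) ^+ 2 *: delta_mx 0 i.
  rewrite BE mulmxA -!rowE row_diag_mx mxE -scalemxAl -rowE row_diag_mx mxE.
  by rewrite scalerA -expr2.
(* The rows e_0 and e_1 are eigenvectors of B for 1^2 and 2^2. *)
apply: (@inner_Aop_GS_dyad _ _ _ _ 1 2) => //.
- by apply: posdefmx_gram; rewrite F0.
- by rewrite lt_eqF // ltr1n.
Qed.

End GurtinSpearMotion.

Theorem mainTheorem3 (R : realType) :
  [/\ corotational (spin_of (@gZJ R)) /\ positive_rate (spin_of (@gZJ R)),
      corotational (spin_of (@gGN R)) /\ positive_rate (spin_of (@gGN R)),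
      corotational (spin_of (@glog R)) /\ positive_rate (spin_of (@glog R))
    & corotational (spin_of (@gGS R)) /\ ~ positive_rate (spin_of (@gGS R))]
  /\
  [/\ Aop_positive (@gZJ R),
      Aop_positive (@gGN R),
      Aop_positive (@glog R)
    & ~ Aop_positive (@gGS R)].
Proof.
have posZJ := Aop_positive_coeff (@spectral_coeff_ZJ R).
have posGN := Aop_positive_coeff (@spectral_coeff_GN R).
have poslog := Aop_positive_coeff (@spectral_coeff_log R).
have rate_pos (g : R -> R -> R) : Aop_positive g -> positive_rate (spin_of g).
  move=> posg B D posB symD D0 F t defF FB FD.
  by rewrite rate_spin_of // FB FD; apply: posg.
have [F [D [defF symD D0 FD inner0]]] := @GS_degenerate R.
have posB := posdefmx_gram (deformation_gradient_unit 0 defF).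
do 2!split.
- by split; [apply/corotational_spin_of/gZJ_anti|apply: rate_pos].
- by split; [apply/corotational_spin_of/gGN_anti|apply: rate_pos].
- by split; [apply/corotational_spin_of/glog_anti|apply: rate_pos].
- split; first exact/corotational_spin_of/gGS_anti.
  move=> /(_ _ _ posB symD D0 F 0 defF erefl FD).
  by rewrite rate_spin_of // FD inner0 ltxx.
- exact: posZJ.
- exact: posGN.
- exact: poslog.
- by move=> /(_ _ _ posB symD D0); rewrite inner0 ltxx.
Qed.
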